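(* \[ \liminf_{n\to\infty}\frac{M(n)-s(n)}{n^{3/2}\sqrt{\log n}}\geq\frac{2}{3\sqrt3}. \]
   Context: $\log$ is the natural logarithm. For an integer $n\geq1$, $\mathcal{M}_n$ is the set (repeated values counted once) of all multinomial coefficient values $\frac{n!}{p_1!\cdots p_t!}$, where $(p_1,\ldots,p_t)$ ranges over all integer partitions of $n$ ($p_1\geq\cdots\geq p_t\geq1$, $p_1+\cdots+p_t=n$). $M(n)=|\mathcal{M}_n|$. A finite set $S$ of integers is a Sidon set if $x+y=u+v$ with $x,y,u,v\in S$ implies that the unordered pairs (with repetition allowed) $\{x,y\}$ and $\{u,v\}$ coincide. $s(n)=\max\{|S|:S\subseteq\mathcal{M}_n,\ S\text{ is Sidon}\}$. *)

(* Defs.v *)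
From mathcomp Require Import all_boot all_order all_algebra finmap.
From mathcomp Require Import all_classical all_reals all_analysis.

Set Implicit Arguments.
Unset Strict Implicit.
Unset Printing Implicit Defensive.

Local Open Scope classical_set_scope.
Local Open Scope fset_scope.
Local Open Scope nat_scope.

Definition is_intpart (n : nat) (p : seq nat) : bool :=
  [&& sorted geq p, all (leq 1) p & sumn p == n].

(* The division is exact when p sums to n. *)
Definition multinomial (n : nat) (p : seq nat) : nat :=
  n`! %/ \prod_(k <- p) k`!.

Definition multinomial_set (n : nat) : set nat :=
  [set multinomial n p | p in [set p : seq nat | is_intpart n p]].

Lemma finite_multinomial_set (n : nat) : finite_set (multinomial_set n).
Proof.
apply: (@sub_finite_set _ _ `I_(n`!).+1); last exact: finite_II.
by move=> _ [p _ <-] /=; rewrite ltnS leq_div.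
Qed.

(* fset_set A has the elements of A when A is finite (and is empty otherwise);
   finiteness is finite_multinomial_set. *)
Definition multinomials (n : nat) : {fset nat} := fset_set (multinomial_set n).

Lemma multinomialsP (n v : nat) :
  reflect (exists2 p, is_intpart n p & multinomial n p = v)
          (v \in multinomials n).
Proof.
rewrite /multinomials in_fset_set; last exact: finite_multinomial_set.
by apply: (iffP idP) => [/set_mem[p ? <-]|[p ? <-]]; [exists p|apply/mem_set; exists p].
Qed.

Definition num_multinomials (n : nat) : nat := #|` multinomials n|.

(* Unordered pairs with repetition are two-element lists up to permutation. *)
Definition is_sidon (S : {fset nat}) : Prop :=
  forall x y u v : nat, x \in S -> y \in S -> u \in S -> v \in S ->
    x + y = u + v -> perm_eq [:: x; y] [:: u; v].

Definition max_sidon (n : nat) : nat :=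
  \max_(S <- fpowerset (multinomials n) | `[< is_sidon S >]) #|` S|.

(* Main.v *)
(* The multinomials 10, 20, 30 of 5 form an arithmetic progression.  Multiplying
   multinomials u of 5 and v of m by binomial(5 + m, 5) gives a multinomial of
   5 + m, so every multinomial of m yields a progression x, 2 x, 3 x among those
   of 5 + m, and each progression has a term outside any given Sidon set.  As a
   missing term serves at most three progressions, M(m) <= 3 (M(m + 5) - s(m + 5)).
   Partitions with parts 2, 3, 5, padded by 1s, already give about (n / 10)^3
   distinct multinomials, because 2!, 3!, 5! are multiplicatively independent.
   So M(n) - s(n) >= n^2 for large n, and n^(3/2) (log n)^(1/2) <= n^2. *)
Require Import Defs.
From mathcomp Require Import all_boot all_order all_algebra finmap.
From mathcomp Require Import all_classical all_reals all_analysis.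
From mathcomp Require Import ring lra zify.

Import Order.TTheory GRing.Theory Num.Theory.

Local Open Scope nat_scope.

Lemma dvdn_prod_fact_sumn (p : seq nat) :
  \prod_(k <- p) k`! %| (sumn p)`!.
Proof.
elim: p => [|k p IHp]; first by rewrite big_nil.
rewrite big_cons /= -(bin_fact (leq_addr (sumn p) k)) addKn.
by rewrite dvdn_mull // dvdn_mul.
Qed.

Lemma multinomialK (n : nat) (p : seq nat) : sumn p = n ->
  multinomial n p * \prod_(k <- p) k`! = n`!.
Proof. by move=> <-; rewrite divnK ?dvdn_prod_fact_sumn. Qed.

Lemma mem_multinomials (n : nat) (p : seq nat) :
  all (leq 1) p -> sumn p = n -> multinomial n p \in multinomials n.
Proof.
move=> p_gt0 p_sum; have perm_p : perm_eq (sort geq p) p by rewrite perm_sort.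
apply/multinomialsP; exists (sort geq p).
  rewrite /is_intpart (perm_all _ perm_p) p_gt0 (perm_sumn perm_p) p_sum eqxx.
  by rewrite sort_sorted // => x y; exact: leq_total.
by rewrite /multinomial (perm_big _ perm_p).
Qed.

(** Concatenating a partition of [k] with one of [m] multiplies the factorial products, so the two
    multinomials multiply up to the factor [(k + m)! / (k! m!)]. *)
Lemma multinomials_mul (k m u v : nat) :
  u \in multinomials k -> v \in multinomials m ->
  'C(k + m, k) * u * v \in multinomials (k + m).
Proof.
move=> /multinomialsP[p /and3P[_ p0 /eqP ps] <-].
move=> /multinomialsP[q /and3P[_ q0 /eqP qs] <-].
have pqs : sumn (p ++ q) = k + m by rewrite sumn_cat ps qs.
have -> : 'C(k + m, k) * multinomial k p * multinomial m q
          = multinomial (k + m) (p ++ q).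
  have gt0 : 0 < \prod_(i <- p ++ q) i`!.
    by apply: prodn_gt0 => i; exact: fact_gt0.
  apply/eqP; rewrite -(eqn_pmul2r gt0) multinomialK // big_cat /=.
  rewrite mulnACA -(mulnA _ _ (\prod_(i <- p) _)) -mulnA multinomialK //.
  by rewrite multinomialK // -(bin_fact (leq_addr m k)) addKn.
by apply: mem_multinomials => //; rewrite all_cat p0.
Qed.

Lemma multinomials5_progression (j : nat) : 0 < j <= 3 ->
  10 * j \in multinomials 5.
Proof.
case: j => [|[|[|[|j]]]] //= _.
- have -> : 10 * 1 = multinomial 5 [:: 3; 2] by rewrite /multinomial !big_cons big_nil.
  exact: mem_multinomials.
- have -> : 10 * 2 = multinomial 5 [:: 3; 1; 1] by rewrite /multinomial !big_cons big_nil.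
  exact: mem_multinomials.
- have -> : 10 * 3 = multinomial 5 [:: 2; 2; 1] by rewrite /multinomial !big_cons big_nil.
  exact: mem_multinomials.
Qed.

(** The relation [x + 3x = 2x + 2x] would force [x = 2x]. *)
Lemma sidon_no_progression (S : {fset nat}) (x : nat) : is_sidon S -> 0 < x ->
  ~~ [&& x \in S, 2 * x \in S & 3 * x \in S].
Proof.
move=> SS x_gt0; apply/negP => /and3P[x1 x2 x3].
have /perm_mem/(_ x) : perm_eq [:: x; 3 * x] [:: 2 * x; 2 * x].
  by apply: SS => //; lia.
by rewrite !inE eqxx /= => /esym; lia.
Qed.

Lemma sidon_deficiency (m : nat) (S : {fset nat}) :
  (S `<=` multinomials (5 + m))%fset -> is_sidon S ->
  num_multinomials m <= 3 * (num_multinomials (5 + m) - #|` S|).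
Proof.
move=> subS SS; pose D := (multinomials (5 + m) `\` S)%fset.
have -> : num_multinomials (5 + m) - #|` S| = #|` D|.
  by rewrite cardfsD; move/fsetIidPr: subS => ->.
pose f v := 'C(5 + m, 5) * 10 * v.
have C_gt0 : 0 < 'C(5 + m, 5) by rewrite bin_gt0 leq_addr.
have inj_f : injective f by move=> u v /eqP; rewrite eqn_pmul2l ?muln_gt0 ?C_gt0 // => /eqP.
(* Some [j * f v] with [j] in 1, 2, 3 lies in [D]; dividing it by [j] recovers [f v]. So [D3]
   contains the image of the injective [f]. *)
pose D3 : seq nat := D ++ map half D ++ map (divn ^~ 3) D.
have -> : 3 * #|` D| = size D3 by rewrite !size_cat !size_map !mulSn addn0.
rewrite -[num_multinomials m](size_map f (multinomials m)).
apply: uniq_leq_size; first by rewrite map_inj_uniq ?fset_uniq.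
move=> _ /mapP[v vM ->]; have fM j : 0 < j <= 3 -> j * f v \in multinomials (5 + m).
  move=> /multinomials5_progression/multinomials_mul/(_ vM).
  by rewrite /f !mulnA -(mulnC j) !mulnA.
have v_gt0 : 0 < v.
  case/multinomialsP: vM => p /and3P[_ _ /eqP/multinomialK p_sum] <-.
  by move: p_sum (fact_gt0 m); case: multinomial => // <-.
have f_gt0 : 0 < f v by rewrite !muln_gt0 C_gt0.
have inD j : 0 < j <= 3 -> j * f v \notin S -> j * f v \in D.
  by move=> j3 jS; rewrite inE jS fM.
rewrite !mem_cat; have := sidon_no_progression _ _ SS f_gt0.
rewrite !negb_and => /or3P[] nS.
- by rewrite -[f v]mul1n inD ?mul1n.
- apply/orP; right; apply/orP; left; apply/mapP; exists (2 * f v); first exact: inD.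
  by rewrite mul2n doubleK.
- apply/orP; right; apply/orP; right; apply/mapP; exists (3 * f v); first exact: inD.
  by rewrite mulKn.
Qed.

Lemma num_multinomials_add_max_sidon (m : nat) :
  num_multinomials m + 3 * max_sidon (5 + m) <= 3 * num_multinomials (5 + m).
Proof.
have fset0_sidon : is_sidon fset0 by move=> x y u v; rewrite inE.
(* The empty Sidon set shows that the truncated subtraction in the next bound is exact. *)
have := sidon_deficiency m _ (fsub0set _) fset0_sidon; rewrite cardfs0 => le0.
suff : max_sidon (5 + m) <= (3 * num_multinomials (5 + m) - num_multinomials m) %/ 3.
  by lia.
apply/bigmax_leqP_seq => S; rewrite fpowersetE => subS /asboolP SS.
have := sidon_deficiency m _ subS SS; have := fsubset_leq_card subS.
by rewrite -/(num_multinomials _); lia.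
Qed.

(** Fewer than [m] copies of each of 2, 3, 5 sum to at most [10 * m], since 2 + 3 + 5 = 10; ones
    fill up the rest without changing the factorial product. *)
Lemma num_multinomials_ge (m n : nat) : 10 * m <= n -> m ^ 3 <= num_multinomials n.
Proof.
move=> mn; pose P (i : 'I_m * 'I_m * 'I_m) := nseq i.1.1 2 ++ nseq i.1.2 3 ++ nseq i.2 5.
have P_sum i : sumn (P i) <= n.
  rewrite !sumn_cat !sumn_nseq; case: i => [[a b] c] /=.
  by have := ltn_ord a; have := ltn_ord b; have := ltn_ord c; lia.
pose Q i := P i ++ nseq (n - sumn (P i)) 1.
have Q_sum i : sumn (Q i) = n by rewrite sumn_cat sumn_nseq mul1n subnKC.
have Q_gt0 i : all (leq 1) (Q i) by rewrite !all_cat !all_nseq !orbT.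
(* The exponents come from [2! = 2], [3! = 2 * 3] and [5! = 2^3 * 3 * 5]. *)
pose F (i : 'I_m * 'I_m * 'I_m) :=
  2 ^ (i.1.1 + i.1.2 + 3 * i.2) * 3 ^ (i.1.2 + i.2) * 5 ^ i.2.
have Q_prod i : \prod_(k <- Q i) k`! = F i.
  rewrite !big_cat !big_nseq !iter_muln_1 /=.
  have fact3X b : 3`! ^ b = 2 ^ b * 3 ^ b by rewrite -expnMn.
  have fact5X c : 5`! ^ c = 2 ^ (3 * c) * 3 ^ c * 5 ^ c by rewrite expnM -!expnMn.
  rewrite fact3X fact5X exp1n muln1 /F !expnD (_ : 2`! = 2) //; ring.
have F_logn p i : prime p -> logn p (F i)
    = (i.1.1 + i.1.2 + 3 * i.2) * (p == 2) + (i.1.2 + i.2) * (p == 3) + i.2 * (p == 5).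
  by move=> pr_p; rewrite !lognM ?muln_gt0 ?expn_gt0 // !lognX !logn_prime.
have inj_Q : injective (fun i => multinomial n (Q i)).
  move=> i j eq_ij; have := multinomialK _ _ (Q_sum i).
  rewrite eq_ij -(multinomialK _ _ (Q_sum j)) => /eqP.
  rewrite eqn_pmul2l; last first.
    by have := fact_gt0 n; rewrite -(multinomialK _ _ (Q_sum j)) muln_gt0 => /andP[].
  rewrite !Q_prod => /eqP eqF.
  have eq_log p (pr_p : prime p) := F_logn p i pr_p; rewrite eqF in eq_log.
  (* The valuations form a triangular system: 5 determines [c], then 3 determines [b], then 2
     determines [a]. *)
  have := eq_log 5 isT; have := eq_log 3 isT; have := eq_log 2 isT; rewrite !F_logn //=.
  case: i j {eq_ij eqF eq_log} => [[a b] c] [[a' b'] c'] /= e2 e3 e5.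
  by congr (_, _, _); apply: val_inj => /=; lia.
have -> : m ^ 3 = size (map (fun i => multinomial n (Q i)) (enum {: 'I_m * 'I_m * 'I_m})).
  by rewrite size_map -cardE !card_prod card_ord !expnS muln1 mulnA.
apply: uniq_leq_size; first by rewrite map_inj_uniq // enum_uniq.
by move=> _ /mapP[i _ ->]; exact: mem_multinomials.
Qed.

Lemma num_multinomials_sub_max_sidon (n : nat) : 5000 <= n ->
  n ^ 2 + max_sidon n <= num_multinomials n.
Proof.
move=> n_ge; have [m mE] : exists m, n = 5 + m by exists (n - 5); rewrite subnKC //; lia.
have := num_multinomials_add_max_sidon m; rewrite -mE.
pose k := m %/ 10; have := @num_multinomials_ge k m ltac:(lia).
(* As [363 = 3 * 11^2], this yields [3 n^2 <= 363 k^2 <= k^3] once [n <= 11 k]. *)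
have k_ge : 363 <= k by lia.
have n_le : n <= 11 * k by lia.
have : n ^ 2 <= 121 * k ^ 2 by rewrite -[121]/(11 ^ 2) -expnMn leq_exp2r.
have : 363 * k ^ 2 <= k ^ 3 by rewrite [k ^ 3]expnS leq_mul2r k_ge orbT.
by lia.
Qed.

Local Open Scope ring_scope.

Lemma powR_sqrt_ln_le (R : realType) (x : R) : 1 <= x ->
  x `^ (3 / 2) * Num.sqrt (ln x) <= x ^+ 2.
Proof.
move=> x_ge1; have x_gt0 : 0 < x by exact: lt_le_trans x_ge1.
have -> : x ^+ 2 = x `^ (3 / 2) * Num.sqrt x.
  rewrite -powR_mulrn ?ltW // -powR12_sqrt ?ltW // -powRD; first by congr (_ `^ _); lra.
  by rewrite gt_eqF ?implybT.
by rewrite ler_wpM2l ?powR_ge0 // ler_wsqrtr // ltW // ln_sublinear.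
Qed.

Theorem theorem1p2 (R : realType) :
  ((2 / (3 * Num.sqrt 3) : R)%:E <=
   limn_einf (fun n : nat =>
     (((num_multinomials n)%:R - (max_sidon n)%:R) /
      (n%:R `^ (3 / 2) * Num.sqrt (ln n%:R)) : R)%:E))%E.
Proof.
(* The quadratic gap makes the ratio at least 1 from 5000 on, and [2 / (3 sqrt 3)] is below 1. *)
apply: (@le_trans _ _ 1%E).
  rewrite lee_fin ler_pdivrMr ?mulr_gt0 ?sqrtr_gt0 // mul1r.
  have : 1 <= Num.sqrt 3 :> R by rewrite -[leLHS]sqrtr1; apply: ler_wsqrtr; lra.
  lra.
rewrite limn_einf_lim; apply: lime_ge; first exact: is_cvg_einfs.
near=> N; apply: le_ereal_inf_tmp => _ /= [n Nn <-].
have n_ge : (5000 <= n)%N by apply: leq_trans Nn; near: N; exact: nbhs_infty_ge.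
have n_gt1 : 1 < n%:R :> R by rewrite ltr1n; lia.
rewrite lee_fin ler_pdivlMr ?mul1r; last first.
  by rewrite mulr_gt0 ?powR_gt0 ?sqrtr_gt0 ?ln_gt0 // (lt_trans ltr01).
apply: le_trans (powR_sqrt_ln_le _ _ (ltW n_gt1)) _.
by rewrite lerBrDr -natrX -natrD ler_nat num_multinomials_sub_max_sidon.
Unshelve. all: by end_near. Qed.
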